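(* Let $G=(V,E,c)$ be a finite connected weighted graph with positive edge conductances, with Laplacian $L$ and effective-resistance matrix $R$. For nonempty $S\subseteq V$ put $\rho_G(S)=\det R[S]/\operatorname{cof}R[S]$. Then for every nonempty $S\subseteq V$, $$\rho_G(S)=\max\{u^{\mathsf T}R[S]u:\ u\in\mathbb{R}^S,\ \mathbf{1}^{\mathsf T}u=1\}.$$ For $|S|\ge2$, the maximizer is unique and equals $$u_S=\rho_G(S)\,R[S]^{-1}\mathbf{1}.$$ Equivalently, if $K=L^S$ is the Kron-reduced Laplacian on $S$, $Q=K^+$, and $q=\operatorname{diag}(Q)\in\mathbb{R}^S$ is the vector of diagonal entries of $Q$, then $$u_S=\frac1{|S|}\mathbf{1}+\frac12 Kq.$$
   Context: $G=(V,E,c)$ is a finite connected undirected graph with edge conductances $c_e>0$; parallel edges are allowed, loops are omitted. After choosing an arbitrary orientation of the edges, let $B\in\mathbb{R}^{V\times E}$ be the incidence matrix and $C=\operatorname{diag}(c_e)$; the weighted Laplacian is $L=BCB^{\mathsf T}$. $M^+$ denotes the Moore--Penrose pseudoinverse of a matrix $M$. The effective resistance between $i,j\in V$ is $R_{ij}=(e_i-e_j)^{\mathsf T}L^+(e_i-e_j)$, and $R=(R_{ij})_{i,j\in V}$. For $A,B\subseteq V$, $M[A,B]=M_{AB}$ is the submatrix with rows in $A$ and columns in $B$, and $M[A]=M[A,A]$. $\mathbf 1$ is the all-ones vector of the appropriate dimension. For a square matrix $A$, $\operatorname{cof}A=\sum_{i,j}(-1)^{i+j}\det A(i|j)$ is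 the sum of all cofactors, where $A(i|j)$ is $A$ with row $i$ and column $j$ deleted; for a $1\times1$ matrix it equals $1$. It is a fact that $\operatorname{cof}R[S]\ne0$ for every nonempty $S$, and that $R[S]$ is invertible when $|S|\ge2$; thus $\rho_G(S)$ is well defined, and $\rho_G(S)=0$ when $|S|=1$. For nonempty $S\subseteq V$ and $I=V\setminus S$, the Kron-reduced Laplacian on $S$ is $L^S=L_{SS}-L_{SI}L_{II}^{-1}L_{IS}$ if $I\neq\varnothing$ (the block $L_{II}$ is positive definite), and $L^S=L$ if $I=\varnothing$. *)

(* Defs.v *)
From HB Require Import structures.
From mathcomp Require Import all_boot all_order all_algebra.
From mathcomp Require Import reals.

Set Implicit Arguments.
Unset Strict Implicit.
Unset Printing Implicit Defensive.

Import Order.TTheory GRing.Theory Num.Theory.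
Local Open Scope ring_scope.

Definition moore_penrose (R : realFieldType) m n
    (A : 'M[R]_(m, n)) (X : 'M[R]_(n, m)) : Prop :=
  [/\ A *m X *m A = A, X *m A *m X = X,
      (A *m X)^T = A *m X & (X *m A)^T = X *m A].

(* If A = C F with C of full column rank and F of full row rank, then
   A^+ = F^T (F F^T)^-1 (C^T C)^-1 C^T; mpinvP and mpinv_unique show that this
   is the unique solution of the four Penrose equations. *)
Definition mpinv (R : realFieldType) m n (A : 'M[R]_(m, n)) : 'M[R]_(n, m) :=
  let C := col_base A in let F := row_base A in
  F^T *m invmx (F *m F^T) *m invmx (C^T *m C) *m C^T.

Lemma gram_unitmx (R : realFieldType) m n (A : 'M[R]_(m, n)) :
  row_free A -> A *m A^T \in unitmx.
Proof.
move=> freeA; rewrite -row_free_unit -kermx_eq0; apply/eqP/row_matrixP => i.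
rewrite row0; set u := row i _.
have uAA0 : u *m A *m A^T = 0.
  by rewrite -mulmxA; apply/sub_kermxP; exact: row_sub.
have /matrixP/(_ 0 0) : (u *m A) *m (u *m A)^T = 0.
  by rewrite trmx_mul mulmxA uAA0 mul0mx.
rewrite !mxE => /eqP; rewrite psumr_eq0 => [|k _]; last first.
  by rewrite [(u *m A)^T _ _]mxE -expr2 sqr_ge0.
move=> /allP uA0; apply/eqP; rewrite -(mulmx_free_eq0 u freeA).
apply/eqP/rowP => k; rewrite [RHS]mxE.
have := uA0 k (mem_index_enum k).
by rewrite /= [(u *m A)^T _ _]mxE -expr2 sqrf_eq0 => /eqP.
Qed.

Lemma mpinvP (R : realFieldType) m n (A : 'M[R]_(m, n)) :
  moore_penrose A (mpinv A).
Proof.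
rewrite /mpinv; move: (mulmx_base A) (col_base_full A) (row_base_free A).
move: (col_base A) (row_base A) => /=; move: (\rank A) => r C F defA fullC freeF.
have uF : F *m F^T \in unitmx by apply: gram_unitmx.
have uC : C^T *m C \in unitmx.
  have := @gram_unitmx R _ _ C^T; rewrite trmxK; apply.
  by move: fullC; rewrite /row_full /row_free mxrank_tr.
set iF := invmx (F *m F^T); set iC := invmx (C^T *m C).
have AX : A *m (F^T *m iF *m iC *m C^T) = C *m iC *m C^T.
  by rewrite -defA !mulmxA -(mulmxA C F) -(mulmxA C _ iF) mulmxV // mulmx1.
have XA : (F^T *m iF *m iC *m C^T) *m A = F^T *m iF *m F.
  by rewrite -defA mulmxA -(mulmxA _ C^T C) -(mulmxA _ iC) mulVmx // mulmx1.
have symF : iF^T = iF by rewrite /iF trmx_inv trmx_mul trmxK.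
have symC : iC^T = iC by rewrite /iC trmx_inv trmx_mul trmxK.
split; rewrite ?AX ?XA.
- by rewrite -defA mulmxA -(mulmxA _ C^T C) -(mulmxA C) mulVmx // mulmx1.
- by rewrite !mulmxA -(mulmxA _ F F^T) -(mulmxA F^T) mulVmx // mulmx1.
- by rewrite !trmx_mul trmxK symC mulmxA.
- by rewrite !trmx_mul trmxK symF mulmxA.
Qed.

Lemma mpinv_unique (R : realFieldType) m n (A : 'M[R]_(m, n))
    (X : 'M[R]_(n, m)) :
  moore_penrose A X -> X = mpinv A.
Proof.
have [] := mpinvP A; move: (mpinv A) => Y AYA YAY sAY sYA.
move=> [AXA XAX sAX sXA].
have AXY : A *m X = A *m Y.
  rewrite -sAX -{1}AYA -(mulmxA (A *m Y)) trmx_mul sAY sAX.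
  by rewrite mulmxA AXA.
have XYA : X *m A = Y *m A.
  rewrite -sXA -{1}AYA -(mulmxA A) mulmxA trmx_mul sYA sXA.
  by rewrite -mulmxA (mulmxA A) AXA.
by rewrite -XAX XYA -mulmxA AXY mulmxA.
Qed.

(* Sum of all cofactors; it is 1 on 1x1 matrices, as \det is 1 in size 0. *)
Definition cof (R : comNzRingType) n (A : 'M[R]_n) : R :=
  \sum_(i < n) \sum_(j < n) cofactor A i j.

(* Real vectors and matrices indexed by a finite type T have dimension #|T|,
   position i standing for enum_val i; those indexed by A : {set T} have
   dimension #|A|, with the same convention. *)
Definition submx_on (R : Type) (T : finType) (M : 'M[R]_#|T|) (A B : {set T}) :
    'M[R]_(#|A|, #|B|) :=
  \matrix_(i < #|A|, j < #|B|) M (enum_rank (enum_val i)) (enum_rank (enum_val j)).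

Definition quad_form (R : pzRingType) n (M : 'M[R]_n) (u : 'cV[R]_n) : R :=
  (u^T *m M *m u) 0 0.

Definition is_maximum (R : realFieldType) (T : Type) (P : T -> Prop)
    (f : T -> R) (m : R) : Prop :=
  (exists2 x, P x & f x = m) /\ forall x, P x -> f x <= m.

Definition is_maximizer (R : realFieldType) (T : Type) (P : T -> Prop)
    (f : T -> R) (x : T) : Prop :=
  P x /\ forall y, P y -> f y <= f x.

(* A connected loopless multigraph with vertex set V, edge set E and positive
   conductances; an edge is oriented from esrc to etgt. *)
Record network (R : realFieldType) (V E : finType) := Network {
  esrc : E -> V;
  etgt : E -> V;
  cond : E -> R;
  esrc_neq_etgt : forall e, esrc e != etgt e;
  cond_gt0 : forall e, 0 < cond e;
  network_connected : forall x y : V,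
    connect (fun v w => [exists e, ((esrc e == v) && (etgt e == w))
                                || ((esrc e == w) && (etgt e == v))]) x y
}.

Section Network.
Variables (R : realFieldType) (V E : finType) (G : network R V E).

Definition incidence : 'M[R]_(#|V|, #|E|) :=
  \matrix_(i, k) ((esrc G (enum_val k) == enum_val i)%:R
                  - (etgt G (enum_val k) == enum_val i)%:R).

Definition cond_mx : 'M[R]_#|E| := diag_mx (\row_k cond G (enum_val k)).

Definition laplacian : 'M[R]_#|V| := incidence *m cond_mx *m incidence^T.

Definition unit_vec (v : V) : 'cV[R]_#|V| := delta_mx (enum_rank v) 0.

Definition eff_res (v w : V) : R :=
  quad_form (mpinv laplacian) (unit_vec v - unit_vec w).

Definition res_mx : 'M[R]_#|V| :=
  \matrix_(i, j) eff_res (enum_val i) (enum_val j).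

Definition res_on (S : {set V}) : 'M[R]_#|S| := submx_on res_mx S S.

Definition rho (S : {set V}) : R := \det (res_on S) / cof (res_on S).

(* When S = setT the correction term is a product through dimension 0, hence
   vanishes, and the reduced Laplacian is the Laplacian itself. *)
Definition kron_laplacian (S : {set V}) : 'M[R]_#|S| :=
  let L := laplacian in let I := ~: S in
  submx_on L S S
    - submx_on L S I *m invmx (submx_on L I I) *m submx_on L I S.

End Network.

(* Main.v *)
Require Import Defs.
From HB Require Import structures.
From mathcomp Require Import all_boot all_order all_algebra.
From mathcomp Require Import reals.
From mathcomp Require Import ring lra.
Import Order.TTheory GRing.Theory Num.Theory.
Local Open Scope ring_scope.

(** Why the theorem is true.  Write A = R[S], let K be the Kron-reduced
    Laplacian on S, Q its pseudoinverse, q the diagonal of Q, and n = #|S|.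

    Kron reduction preserves both what makes a Laplacian of a connected graph
    (symmetric, positive semidefinite, with kernel spanned by 1;
    schur_conn_lap) and the effective resistances between vertices of S
    (quad_mpinv_schur): solving L x = f for f supported on S amounts to solving
    K y = f on S and extending y harmonically.  Hence A has entries
    q_i + q_j - 2 Q_ij, that is, A = q 1^T + 1 q^T - 2 Q (res_onE).

    Set w = 1/n + K q / 2.  As K 1 = 0 and Q K is the projection orthogonal to
    1, the vector w has sum 1 and A w = m 1, where
    m = 2 (1^T q) / n + q^T K q / 2 (resistance_equilibrium).  For u of sum 1,
    the vector u - w has sum 0, where the form of A is -2 Q, so that
    u^T A u = m - 2 (u - w)^T Q (u - w) (quad_resistance).  Since Q is positive
    definite on vectors of sum 0, w is the unique maximizer and m the maximum.

    It remains to recognize m and w.  Multiplying A w = m 1 by the adjugate of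
    A and by 1^T gives det A = m cof A (det_cof).  If n >= 2 then m > 0, which
    makes A invertible; so cof A is nonzero, m = det A / cof A, and
    w = m A^-1 1.  If n = 1 then cof A = 1. *)

Set Implicit Arguments.
Unset Strict Implicit.

(** * Scalar products and the sum of cofactors *)

Definition ones {R : realFieldType} {n} : 'cV[R]_n := const_mx 1.

Definition dot {R : realFieldType} {n} (u v : 'cV[R]_n) : R := (u^T *m v) 0 0.

Lemma unitmx_inj (R : realFieldType) n (A : 'M[R]_n) :
  (forall x : 'cV_n, A *m x = 0 -> x = 0) -> A \in unitmx.
Proof.
move=> A0; rewrite -unitmx_tr -row_free_unit -kermx_eq0.
apply/eqP/row_matrixP => i; rewrite row0; apply: trmx_inj; rewrite trmx0.
apply: A0; apply: trmx_inj; rewrite trmx_mul trmxK trmx0.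
by apply/sub_kermxP; exact: row_sub.
Qed.

Section Dot.
Variables (R : realFieldType) (n : nat).
Implicit Types (u v w : 'cV[R]_n) (M : 'M[R]_n).

Lemma dotE u v : dot u v = \sum_i u i 0 * v i 0.
Proof. by rewrite /dot mxE; apply: eq_bigr => i _; rewrite mxE. Qed.

Lemma dotC u v : dot u v = dot v u.
Proof. by rewrite !dotE; apply: eq_bigr => i _; rewrite mulrC. Qed.

Lemma dotDr u v w : dot u (v + w) = dot u v + dot u w.
Proof. by rewrite /dot mulmxDr mxE. Qed.

Lemma dotDl u v w : dot (u + v) w = dot u w + dot v w.
Proof. by rewrite dotC dotDr !(dotC w). Qed.

Lemma dotBr u v w : dot u (v - w) = dot u v - dot u w.
Proof. by rewrite /dot mulmxBr !mxE. Qed.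

Lemma dotZr a u v : dot u (a *: v) = a * dot u v.
Proof. by rewrite /dot -scalemxAr mxE. Qed.

Lemma dot_mulmx m u (M : 'M[R]_(n, m)) (v : 'cV_m) :
  dot u (M *m v) = dot (M^T *m u) v.
Proof. by rewrite /dot trmx_mul trmxK mulmxA. Qed.

Lemma mul_rank1 m (u : 'cV[R]_m) v w : u *m v^T *m w = dot v w *: u.
Proof. by rewrite -mulmxA [v^T *m w]mx11_scalar mul_mx_scalar. Qed.

Lemma quad_formE M u : quad_form M u = dot u (M *m u).
Proof. by rewrite /quad_form /dot mulmxA. Qed.

Lemma dot_ones : dot (ones : 'cV[R]_n) ones = n%:R.
Proof.
rewrite dotE (eq_bigr (fun=> 1)) ?sumr_const ?card_ord // => i _.
by rewrite !mxE mulr1.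
Qed.

End Dot.

Lemma cofE (R : realFieldType) n (A : 'M[R]_n) : cof A = dot ones (\adj A *m ones).
Proof.
rewrite dotE /cof exchange_big; apply: eq_bigr => i _ /=.
rewrite [ones _ _]mxE mul1r mxE; apply: eq_bigr => j _.
by rewrite [ones _ _]mxE mulr1 mxE.
Qed.

(** Multiply A w = m 1 by 1^T adj(A) on the left: adj(A) A = det(A), and
    1^T adj(A) 1 is the sum of the cofactors. *)
Lemma det_cof (R : realFieldType) n (A : 'M[R]_n) w m :
  dot ones w = 1 -> A *m w = m *: ones -> \det A = m * cof A.
Proof.
move=> w1 Aw; rewrite cofE -dotZr scalemxAr -Aw mulmxA mul_adj_mx.
by rewrite mul_scalar_mx dotZr w1 mulr1.
Qed.

Lemma cof_dim1 (R : realFieldType) n (A : 'M[R]_n) : n = 1%N -> cof A = 1.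
Proof.
move=> n1; move: A; rewrite n1 => A.
by rewrite /cof !big_ord1 /cofactor det_mx00 mulr1.
Qed.

(** * Laplacian-like matrices and their pseudoinverses *)

(** The properties of the Laplacian of a connected graph that the argument
    uses.  Unlike the combinatorial form, they pass to Schur complements
    directly. *)
Definition conn_lap {R : realFieldType} {n} (M : 'M[R]_n) : Prop :=
  [/\ M^T = M, M *m ones = 0, forall x, 0 <= quad_form M x
    & forall x, quad_form M x = 0 -> exists a, x = a *: ones].

(** The transpose of X satisfies the Penrose equations of the transpose of M,
    and these have only one solution. *)
Lemma moore_penrose_sym (R : realFieldType) n (M X : 'M[R]_n) :
  M^T = M -> moore_penrose M X -> X^T = X.
Proof.
move=> symM mpX; rewrite [RHS](mpinv_unique mpX); apply: mpinv_unique.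
have [MXM XMX sMX sXM] := mpX.
split.
- by have := congr1 trmx MXM; rewrite !trmx_mul symM mulmxA.
- by have := congr1 trmx XMX; rewrite !trmx_mul symM mulmxA.
- by rewrite trmx_mul trmxK symM -sXM trmx_mul symM.
- by rewrite trmx_mul trmxK symM -sMX trmx_mul symM.
Qed.

Section ConnLap.
Variables (R : realFieldType) (n : nat) (M X : 'M[R]_n).
Hypotheses (n_gt0 : (0 < n)%N) (lapM : conn_lap M) (mpX : moore_penrose M X).

Let nE : n%:R != 0 :> R. Proof. by rewrite pnatr_eq0 -lt0n. Qed.

(** M kills x - X M x, which is therefore a multiple of 1; the multiple is
    read off from scalar products with 1, as the symmetric matrix X M kills 1. *)
Lemma mul_mpinv_lap (x : 'cV_n) :
  X *m (M *m x) = x - (n%:R^-1 * dot ones x) *: ones.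
Proof.
have [_ M1 _ kerM] := lapM; have [MXM _ _ sXM] := mpX.
have [a defa] : exists a, x - X *m (M *m x) = a *: ones.
  by apply: kerM; rewrite quad_formE mulmxBr !mulmxA MXM subrr /dot mulmx0 mxE.
have : dot ones (x - X *m (M *m x)) = a * n%:R by rewrite defa dotZr dot_ones.
rewrite dotBr mulmxA dot_mulmx sXM -mulmxA M1 mulmx0 {2}/dot trmx0 mul0mx mxE subr0.
by move=> ->; rewrite mulrC mulfK // -defa opprB addrC subrK -mulmxA.
Qed.

Lemma mpinv_lap_comm : M *m X = X *m M.
Proof.
have [symM _ _ _] := lapM; have [_ _ _ sXM] := mpX.
by rewrite -sXM trmx_mul symM (moore_penrose_sym symM mpX).
Qed.

Lemma mul_lap_mpinv (x : 'cV_n) :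
  M *m (X *m x) = x - (n%:R^-1 * dot ones x) *: ones.
Proof. by rewrite mulmxA mpinv_lap_comm -mulmxA mul_mpinv_lap. Qed.

Lemma mpinv_lap_ones : X *m ones = 0.
Proof.
have [_ M1 _ _] := lapM; have [_ XMX _ _] := mpX.
by rewrite -XMX -mulmxA -mulmxA [M *m _]mulmxA mpinv_lap_comm -mulmxA M1 !mulmx0.
Qed.

(** By X = X M X and the symmetry of X, so positivity carries over from M. *)
Lemma quad_mpinv (x : 'cV_n) : quad_form X x = quad_form M (X *m x).
Proof.
have [symM _ _ _] := lapM; have [_ XMX _ _] := mpX.
by rewrite !quad_formE -{1}XMX -!mulmxA dot_mulmx (moore_penrose_sym symM mpX).
Qed.

Lemma quad_mpinv_ge0 (x : 'cV_n) : 0 <= quad_form X x.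
Proof. by have [_ _ psdM _] := lapM; rewrite quad_mpinv. Qed.

Lemma quad_mpinv_eq0 (x : 'cV_n) : quad_form X x = 0 -> exists a, x = a *: ones.
Proof.
have [_ M1 _ kerM] := lapM; rewrite quad_mpinv => /kerM[a Xx].
exists (n%:R^-1 * dot ones x); apply/eqP.
by rewrite -subr_eq0 -mul_lap_mpinv Xx -scalemxAr M1 scaler0.
Qed.

Lemma quad_mpinv_eq0_dot0 (x : 'cV_n) :
  dot ones x = 0 -> quad_form X x = 0 -> x = 0.
Proof.
move=> x1 /quad_mpinv_eq0[a defx]; move/eqP: x1.
by rewrite defx dotZr dot_ones mulf_eq0 (negPf nE) orbF => /eqP->; rewrite scale0r.
Qed.

End ConnLap.

(** * Resistance matrices of a Laplacian *)

Section Resistance.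
Variables (R : realFieldType) (n : nat) (K Q : 'M[R]_n).
Hypotheses (n_gt0 : (0 < n)%N) (lapK : conn_lap K) (mpQ : moore_penrose K Q).
Let q : 'cV_n := \col_i Q i i.

(** The matrix of effective resistances q_i + q_j - 2 Q_ij in matrix form; see
    resistance_mxE. *)
Definition resistance_mx : 'M_n := q *m ones^T + ones *m q^T - 2 *: Q.

Definition equilibrium : 'cV_n := n%:R^-1 *: ones + 2^-1 *: (K *m q).

Definition radius : R := 2 / n%:R * dot ones q + 2^-1 * quad_form K q.

Let nE : n%:R != 0 :> R. Proof. by rewrite pnatr_eq0 -lt0n. Qed.

Lemma resistance_mxE i j :
  resistance_mx i j = quad_form Q (delta_mx i 0 - delta_mx j 0).
Proof.
have symQ : Q^T = Q by have [symK _ _ _] := lapK; exact: moore_penrose_sym mpQ.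
have Qji : Q j i = Q i j by rewrite -[in LHS]symQ mxE.
rewrite /quad_form [(_ - _)^T]linearB /= !trmx_delta mulmxBr !mulmxBl -!rowE.
rewrite -!colE !mxE !big_ord1 !mxE Qji; ring.
Qed.

Lemma resistance_mul x :
  resistance_mx *m x = dot ones x *: q + dot q x *: ones - 2 *: (Q *m x).
Proof. by rewrite !mulmxDl mulNmx !mul_rank1 -scalemxAl. Qed.

Lemma dot_ones_equilibrium : dot ones equilibrium = 1.
Proof.
have [symK K1 _ _] := lapK.
rewrite dotDr !dotZr dot_ones dot_mulmx symK K1 /dot trmx0 mul0mx mxE.
by rewrite mulr0 addr0 mulVf.
Qed.

(** The terms of A w are q, -2 Q w = -Q K q = (mean of q) 1 - q, and
    (q^T w) 1: the two copies of q cancel. *)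
Lemma resistance_equilibrium :
  resistance_mx *m equilibrium = radius *: ones.
Proof.
rewrite resistance_mul dot_ones_equilibrium /equilibrium mulmxDr -!scalemxAr.
rewrite (mpinv_lap_ones lapK mpQ) (mul_mpinv_lap n_gt0 lapK mpQ).
rewrite scaler0 add0r dotDr !dotZr -quad_formE.
rewrite scale1r scalerA mulfV ?pnatr_eq0 // scale1r dotC /radius.
by apply/colP => i; rewrite !mxE; ring.
Qed.

Lemma resistance_sym : resistance_mx^T = resistance_mx.
Proof.
have symQ : Q^T = Q by have [symK _ _ _] := lapK; exact: moore_penrose_sym mpQ.
apply/matrixP => i j; rewrite !mxE !big_ord1 !mxE.
have -> : Q j i = Q i j by rewrite -[in LHS]symQ mxE.
ring.
Qed.

Lemma quad_resistance_dot0 d :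
  dot ones d = 0 -> quad_form resistance_mx d = - 2 * quad_form Q d.
Proof.
move=> d1; rewrite !quad_formE resistance_mul d1 scale0r add0r dotBr !dotZr.
by rewrite [dot d ones]dotC d1 mulr0 sub0r mulNr.
Qed.

Lemma dot_equilibrium_resistance x :
  dot equilibrium (resistance_mx *m x) = radius * dot ones x.
Proof.
by rewrite dot_mulmx resistance_sym resistance_equilibrium dotC dotZr dotC.
Qed.

(** Expand at the equilibrium: the linear term vanishes because A w is a
    multiple of 1 and the displacement u - w has sum 0. *)
Lemma quad_resistance u : dot ones u = 1 ->
  quad_form resistance_mx u = radius - 2 * quad_form Q (u - equilibrium).
Proof.
move=> u1; set d := u - equilibrium.
have d1 : dot ones d = 0 by rewrite dotBr u1 dot_ones_equilibrium subrr.
have -> : u = equilibrium + d by rewrite addrC subrK.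
move: d d1 => d d1.
rewrite quad_formE mulmxDr dotDr !(dotDl equilibrium) !dot_equilibrium_resistance.
rewrite resistance_equilibrium dotZr [dot d ones]dotC -quad_formE.
rewrite (quad_resistance_dot0 d1) d1 dot_ones_equilibrium; ring.
Qed.

(** The diagonal entries of Q are nonnegative, and one of them vanishes only if
    a basis vector is constant. *)
Lemma radius_gt0 : (1 < n)%N -> 0 < radius.
Proof.
move=> n_gt1; have [_ _ psdK _] := lapK.
have qE i : q i 0 = quad_form Q (delta_mx i 0).
  by rewrite mxE /quad_form trmx_delta -rowE -colE !mxE.
apply: ltr_wpDr; first by rewrite mulr_ge0 ?invr_ge0.
rewrite mulr_gt0 ?divr_gt0 ?ltr0n // dotE lt0r.
have q_ge0 i : 0 <= ones i 0 * q i 0.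
  by rewrite mxE mul1r qE (quad_mpinv_ge0 lapK mpQ).
rewrite sumr_ge0 // andbT psumr_neq0 //; apply/hasP.
(* Comparing coordinates 0 and 1 shows that the basis vector at 0 is not
   constant. *)
exists (Ordinal n_gt0); first exact: mem_index_enum.
rewrite lt0r q_ge0 mxE mul1r andbT; apply/eqP.
rewrite qE => /(quad_mpinv_eq0 n_gt0 lapK mpQ)[a /colP eq_a].
have := eq_a (Ordinal n_gt1); have := eq_a (Ordinal n_gt0).
by rewrite !mxE /= => <- /eqP; rewrite eq_sym oner_eq0.
Qed.

(** If A x = 0, then w^T A x = m (1^T x) forces x to have sum 0, since m > 0;
    on such vectors the form of A is definite. *)
Lemma resistance_unitmx : (1 < n)%N -> resistance_mx \in unitmx.
Proof.
move=> n_gt1; apply: unitmx_inj => x Ax0.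
have x1 : dot ones x = 0.
  have /eqP := dot_equilibrium_resistance x.
  rewrite Ax0 {1}/dot mulmx0 mxE eq_sym mulf_eq0 gt_eqF ?radius_gt0 //=.
  by move/eqP.
apply: (quad_mpinv_eq0_dot0 n_gt0 lapK mpQ x1).
have := quad_resistance_dot0 x1.
by rewrite quad_formE Ax0 {1}/dot mulmx0 mxE; lra.
Qed.

End Resistance.

(** * Kron reduction *)

Section Kron.
Variables (R : realFieldType) (N m k : nat).
Variables (P : 'M[R]_(m, N)) (I : 'M[R]_(k, N)) (L : 'M[R]_N).
(* P and I select complementary sets of coordinates: P the boundary vertices
   that are kept, I the interior vertices that are eliminated.  In this form the
   block computations need no reindexing. *)
Hypotheses (PP : P *m P^T = 1%:M) (II : I *m I^T = 1%:M) (PI : P *m I^T = 0).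
Hypothesis PI1 : P^T *m P + I^T *m I = 1%:M.
Hypotheses (P1 : P *m ones = ones) (I1 : I *m ones = ones).
Hypotheses (m_gt0 : (0 < m)%N) (lapL : conn_lap L).

Let D := I *m L *m I^T.

Definition schur : 'M_m :=
  P *m L *m P^T - P *m L *m I^T *m invmx D *m (I *m L *m P^T).

(** The interior values are those for which L x vanishes on the interior. *)
Definition harmonic_ext (y : 'cV_m) : 'cV_N :=
  P^T *m y - I^T *m (invmx D *m (I *m L *m P^T *m y)).

(** A vector of the kernel of D, extended by 0, has energy 0, so it is constant;
    and it vanishes on the boundary, which is not empty. *)
Lemma interior_unitmx : D \in unitmx.
Proof.
have [_ _ _ kerL] := lapL; apply: unitmx_inj => z Dz0.
have [|a Iz] := kerL (I^T *m z).
  by rewrite quad_formE dotC dot_mulmx trmxK !mulmxA -/D Dz0 /dot trmx0 mul0mx mxE.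
have /colP/(_ (Ordinal m_gt0)) : a *: ones = 0 :> 'cV[R]_m.
  by rewrite -P1 scalemxAr -Iz mulmxA PI mul0mx.
rewrite !mxE mulr1 => a0.
by rewrite -[z]mul1mx -II -mulmxA Iz a0 scale0r mulmx0.
Qed.

Lemma mulP_harmonic_ext y : P *m harmonic_ext y = y.
Proof. by rewrite mulmxBr !mulmxA PP PI !mul0mx mul1mx subr0. Qed.

(** The current that maintains the boundary potential y is supported on the
    boundary, where it is given by the reduced Laplacian.  All properties of the
    reduction follow from this identity. *)
Lemma mulL_harmonic_ext y : L *m harmonic_ext y = P^T *m (schur *m y).
Proof.
rewrite -[LHS]mul1mx -PI1 mulmxDl.
have ILh0 : I *m (L *m harmonic_ext y) = 0.
  rewrite mulmxA mulmxBr [I *m L *m (I^T *m _)]mulmxA -/D.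
  by rewrite [D *m _]mulmxA mulmxV ?interior_unitmx // mul1mx mulmxA subrr.
rewrite -[I^T *m I *m _]mulmxA ILh0 mulmx0.
by rewrite addr0 /harmonic_ext /schur mulmxBl !mulmxBr !mulmxA.
Qed.

Lemma quad_schur y : quad_form schur y = quad_form L (harmonic_ext y).
Proof.
by rewrite !quad_formE mulL_harmonic_ext [RHS]dot_mulmx trmxK mulP_harmonic_ext.
Qed.

Lemma harmonic_ext_ones : harmonic_ext ones = ones.
Proof.
have [_ L1 _ _] := lapL.
have split1 : ones = P^T *m ones + I^T *m ones :> 'cV[R]_N.
  by rewrite -P1 -I1 !mulmxA -mulmxDl PI1 mul1mx.
have : I *m (L *m ones) = 0 by rewrite L1 mulmx0.
rewrite [X in L *m X]split1 !mulmxDr !mulmxA -/D => /eqP.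
rewrite addr_eq0 /harmonic_ext => /eqP->.
by rewrite mulmxN mulmxA mulVmx ?interior_unitmx // mul1mx mulmxN opprK -split1.
Qed.

Lemma schur_conn_lap : conn_lap schur.
Proof.
have [symL L1 psdL kerL] := lapL; split.
- have symD : D^T = D by rewrite !trmx_mul trmxK symL mulmxA.
  by rewrite linearB /= !trmx_mul !trmxK trmx_inv symD symL /schur !mulmxA.
- rewrite -[LHS]mul1mx -PP -mulmxA -mulL_harmonic_ext harmonic_ext_ones.
  by rewrite L1 mulmx0.
- by move=> y; rewrite quad_schur.
- move=> y; rewrite quad_schur => /kerL[a ya]; exists a.
  by rewrite -[LHS]mulP_harmonic_ext ya -scalemxAr P1.
Qed.

(** With z = Q y, so that K z = y, the harmonic extension x of z satisfies
    L x = P^T y; both sides are then the energy of x. *)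
Lemma quad_mpinv_schur X Q y :
    moore_penrose L X -> moore_penrose schur Q -> dot ones y = 0 ->
  quad_form X (P^T *m y) = quad_form Q y.
Proof.
move=> mpX mpQ y1; have [symL _ _ _] := lapL; have [LXL _ _ _] := mpX.
rewrite (quad_mpinv schur_conn_lap mpQ) quad_schur.
have <- : L *m harmonic_ext (Q *m y) = P^T *m y.
  rewrite mulL_harmonic_ext (mul_lap_mpinv m_gt0 schur_conn_lap mpQ).
  by rewrite y1 mulr0 scale0r subr0.
by rewrite !quad_formE dotC dot_mulmx symL dotC !mulmxA LXL.
Qed.

End Kron.

(** * Networks *)

Section Select.
Variables (R : realFieldType) (V : finType).
Implicit Types (A B : {set V}).

Definition sel A : 'M[R]_(#|A|, #|V|) :=
  \matrix_(i, j) (enum_rank (enum_val i) == j)%:R.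

Lemma sel_mul A m (M : 'M[R]_(#|V|, m)) i j :
  (sel A *m M) i j = M (enum_rank (enum_val i)) j.
Proof.
rewrite mxE (bigD1 (enum_rank (enum_val i))) //= mxE eqxx mul1r.
rewrite big1 ?addr0 // => k /negPf; rewrite eq_sym mxE => ->; exact: mul0r.
Qed.

Lemma mul_tr_sel A m (M : 'M[R]_(m, #|V|)) i j :
  (M *m (sel A)^T) i j = M i (enum_rank (enum_val j)).
Proof. by rewrite -[in LHS](trmxK M) -trmx_mul mxE sel_mul mxE. Qed.

Lemma submx_onE (M : 'M[R]_#|V|) A B :
  submx_on M A B = sel A *m M *m (sel B)^T.
Proof. by apply/matrixP=> i j; rewrite mul_tr_sel sel_mul mxE. Qed.

Lemma sel_trK A : sel A *m (sel A)^T = 1%:M.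
Proof.
by apply/matrixP=> i j; rewrite sel_mul !mxE (inj_eq enum_rank_inj)
  (inj_eq enum_val_inj) eq_sym.
Qed.

Lemma sel_ones A : sel A *m ones = ones.
Proof. by apply/matrixP=> i j; rewrite sel_mul !mxE. Qed.

Lemma sel_setC A : sel A *m (sel (~: A))^T = 0.
Proof.
apply/matrixP=> i j; rewrite sel_mul !mxE (inj_eq enum_rank_inj).
case: eqP => // eq_ij; have := enum_valP j.
by rewrite eq_ij inE enum_valP.
Qed.

Lemma tr_sel_mul A (i j : 'I_#|V|) :
  ((sel A)^T *m sel A) i j = ((i == j) && (enum_val i \in A))%:R.
Proof.
rewrite mxE; have [Ai | notAi] := boolP (enum_val i \in A); last first.
  rewrite andbF big1 // => k _; rewrite !mxE; case: eqP => [def_i | _].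
    by rewrite -def_i enum_rankK enum_valP in notAi.
  by rewrite mul0r.
rewrite andbT (bigD1 (enum_rank_in Ai (enum_val i))) //= big1 => [|k /eqP nk].
  by rewrite !mxE enum_rankK_in // enum_valK eqxx mul1r addr0.
rewrite !mxE; case: eqP => [def_i | _]; last by rewrite mul0r.
by case: nk; apply: enum_val_inj; rewrite enum_rankK_in // -def_i enum_rankK.
Qed.

Lemma sel_partition A :
  (sel A)^T *m sel A + (sel (~: A))^T *m sel (~: A) = 1%:M.
Proof.
apply/matrixP=> i j; rewrite mxE !tr_sel_mul inE mxE.
by case: (i == j); case: (_ \in _); rewrite ?addr0 ?add0r.
Qed.

End Select.

Section Network.
Variables (R : realFieldType) (V E : finType) (G : network R V E).

Lemma tr_incidence_mul (x : 'cV[R]_#|V|) k :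
  ((incidence G)^T *m x) k 0 =
    x (enum_rank (esrc G (enum_val k))) 0 - x (enum_rank (etgt G (enum_val k))) 0.
Proof.
rewrite mxE.
transitivity (\sum_i ((i == enum_rank (esrc G (enum_val k)))%:R * x i 0
   - (i == enum_rank (etgt G (enum_val k)))%:R * x i 0)).
  apply: eq_bigr => i _; rewrite !mxE mulrBl.
  have valE v : (v == enum_val i) = (i == enum_rank v).
    by rewrite -(inj_eq enum_rank_inj) enum_valK eq_sym.
  by rewrite !valE.
have sum1 j : \sum_i (i == j)%:R * x i 0 = x j 0.
  rewrite (bigD1 j) //= eqxx mul1r big1 ?addr0 // => i /negPf->; exact: mul0r.
by rewrite sumrB !sum1.
Qed.

Lemma quad_laplacian (x : 'cV[R]_#|V|) :
  quad_form (laplacian G) x =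
    \sum_k cond G (enum_val k) * ((incidence G)^T *m x) k 0 ^+ 2.
Proof.
rewrite quad_formE /laplacian -!mulmxA dot_mulmx dotE; move: (_ *m x) => y.
by apply: eq_bigr => k _; rewrite mul_diag_mx !mxE; ring.
Qed.

(** The energy of x is the sum of c_e times the squared difference of x across
    e; if it vanishes, x agrees at the ends of each edge, hence everywhere by
    connectedness. *)
Lemma laplacian_conn_lap (v0 : V) : conn_lap (laplacian G).
Proof.
split.
- by rewrite /laplacian /cond_mx !trmx_mul trmxK tr_diag_mx mulmxA.
- rewrite /laplacian -mulmxA (_ : _^T *m ones = 0) ?mulmx0 //.
  by apply/colP=> k; rewrite tr_incidence_mul !mxE subrr.
- move=> x; rewrite quad_laplacian sumr_ge0 // => k _.
  by rewrite mulr_ge0 ?sqr_ge0 // ltW ?cond_gt0.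
move=> x; rewrite quad_laplacian => /eqP; rewrite psumr_eq0 => [/allP x0 | k _].
  pose f v := x (enum_rank v) 0.
  have f_edge e : f (esrc G e) = f (etgt G e).
    have /= := x0 (enum_rank e) (mem_index_enum _).
    rewrite mulf_eq0 gt_eqF ?cond_gt0 //= sqrf_eq0 tr_incidence_mul enum_rankK.
    by rewrite subr_eq0 => /eqP.
  exists (f v0); apply/colP=> i; rewrite !mxE mulr1 -[i]enum_valK -/(f _).
  apply/eqP; have := network_connected G v0 (enum_val i).
  move/(@closed_connect _ _ [pred v | f v == f v0]).
  rewrite !inE eqxx => <- // v w /existsP[e].
  by rewrite !inE => /orP[] /andP[/eqP<- /eqP<-]; rewrite f_edge.
by rewrite mulr_ge0 ?sqr_ge0 // ltW ?cond_gt0.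
Qed.

Lemma kron_laplacianE S :
  kron_laplacian G S = schur (sel R S) (sel R (~: S)) (laplacian G).
Proof. by rewrite /kron_laplacian !submx_onE. Qed.

Lemma kron_conn_lap S : S != set0 -> conn_lap (kron_laplacian G S).
Proof.
move=> S0; have [v0 _] := set0Pn _ S0; rewrite kron_laplacianE.
apply: schur_conn_lap; rewrite ?sel_trK ?sel_setC ?sel_partition ?sel_ones //.
  by rewrite card_gt0.
exact: laplacian_conn_lap.
Qed.

(** The resistance between two vertices of S is the value of the pseudoinverse
    of L at a difference of two basis vectors supported on S, and the reduction
    preserves this value. *)
Lemma res_onE S : S != set0 ->
  res_on G S = resistance_mx (mpinv (kron_laplacian G S)).
Proof.
move=> S0; have [v0 _] := set0Pn _ S0.
have S_gt0 : (0 < #|S|)%N by rewrite card_gt0.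
apply/matrixP=> i j.
rewrite (resistance_mxE (kron_conn_lap S0) (mpinvP _)).
have sel_delta l : (sel R S)^T *m delta_mx l 0 = unit_vec R (enum_val l).
  by apply/colP=> h; rewrite -colE !mxE andbT eq_sym.
(* Only the matrix is rewritten, so the pseudoinverse keeps its form. *)
have mpK := mpinvP (kron_laplacian G S).
rewrite [K in moore_penrose K]kron_laplacianE in mpK.
rewrite -(quad_mpinv_schur (sel_trK _ _) (sel_trK _ _) (sel_setC _ _)
  (sel_partition _ _) (sel_ones _ _) (sel_ones _ _) S_gt0 (laplacian_conn_lap v0)
  (mpinvP _) mpK).
  by rewrite !mxE /eff_res mulmxBr !sel_delta !enum_rankK.
rewrite dotBr !dotE.
have sumd l : \sum_h (ones h 0 * delta_mx l 0 h 0 : R) = 1 :> R.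
  rewrite (bigD1 l) //= big1 => [|h /negPf nhl].
    by rewrite !mxE !eqxx mulr1 addr0.
  by rewrite !mxE nhl mulr0.
by rewrite !sumd subrr.
Qed.

End Network.

Unset Implicit Arguments.
Set Strict Implicit.

Theorem proposition4p1 (R : realType) (V E : finType) (G : network R V E)
    (S : {set V}) (S_neq0 : S != set0) :
  let one : 'cV[R]_#|S| := const_mx 1 in
  let feasible := fun u : 'cV[R]_#|S| => (one^T *m u) 0 0 = 1 in
  let uS := rho G S *: (invmx (res_on G S) *m one) in
  let K := kron_laplacian G S in
  let Q := mpinv K in
  let q := \col_(i < #|S|) Q i i in
  is_maximum feasible (quad_form (res_on G S)) (rho G S)
  /\ ((2 <= #|S|)%N ->
      (forall u, is_maximizer feasible (quad_form (res_on G S)) u <-> u = uS)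
      /\ uS = #|S|%:R^-1 *: one + 2^-1 *: (K *m q)).
Proof.
move=> one feasible uS K Q q.
have n_gt0 : (0 < #|S|)%N by rewrite card_gt0.
have lapK : conn_lap K := kron_conn_lap G S_neq0.
have mpQ : moore_penrose K Q := mpinvP K.
have defA := res_onE G S_neq0; rewrite -/K -/Q in defA.
set w := equilibrium K Q; set m := radius K Q.
have w1 : dot ones w = 1 := dot_ones_equilibrium Q n_gt0 lapK.
have Aw : res_on G S *m w = m *: ones.
  by rewrite defA; exact: resistance_equilibrium.
have quadA u : feasible u ->
    quad_form (res_on G S) u = m - 2 * quad_form Q (u - w).
  by rewrite defA; exact: quad_resistance.
have quadw : quad_form (res_on G S) w = m.
  by rewrite quad_formE Aw dotZr dotC w1 mulr1.
have detA := det_cof w1 Aw.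
have invA1 : (1 < #|S|)%N -> m *: (invmx (res_on G S) *m ones) = w.
  move=> n_gt1; rewrite scalemxAr -Aw mulKmx // defA.
  exact: resistance_unitmx n_gt0 lapK mpQ n_gt1.
have rhoE : rho G S = m.
  rewrite /rho detA mulfK //.
  have [n_gt1 | n_le1] := ltnP 1 #|S|.
    have := resistance_unitmx n_gt0 lapK mpQ n_gt1.
    by rewrite -defA unitmxE unitfE detA mulf_eq0 negb_or => /andP[].
  have n1 : #|S| = 1%N by apply/eqP; rewrite eqn_leq n_le1.
  by rewrite cof_dim1 ?oner_eq0.
have quadQ_ge0 := quad_mpinv_ge0 lapK mpQ.
have quad_le u : feasible u -> quad_form (res_on G S) u <= m.
  by move=> /quadA->; rewrite gerBl mulr_ge0.
split; first by rewrite rhoE; split => //; exists w.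
move=> n_gt1.
have uSE : uS = w by rewrite /uS rhoE; exact: invA1.
split => [u|]; last exact: uSE.
rewrite uSE; split => [[u1 max_u] | ->]; last first.
  by split=> // v /quad_le; rewrite quadw.
apply/eqP; rewrite -subr_eq0; apply/eqP.
apply: (quad_mpinv_eq0_dot0 n_gt0 lapK mpQ).
  by rewrite dotBr w1 [dot _ u]u1 subrr.
have := max_u w w1; have := quadQ_ge0 (u - w).
by rewrite quadw quadA //; lra.
Qed.
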